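(* Let $a, b, \mu, \nu$ be positive real numbers, and suppose that the following three conditions hold: (i) $\dfrac{\Gamma(a+2\mu)}{\Gamma(a+3\mu)}<\dfrac{3\Gamma(b+3\nu)}{8\Gamma(b+2\nu)}$; (ii) $\dfrac{\Gamma(a+\mu)\Gamma(a+3\mu)}{\Gamma^2(a+2\mu)}<\dfrac{16\Gamma^2(b+2\nu)}{9\Gamma(b+\nu)\Gamma(b+3\nu)}$; (iii) $\dfrac{2\Gamma(a)\Gamma(b)}{\Gamma(a+\mu)\Gamma(b+\nu)}-\dfrac{3(1-e)\Gamma(a)\Gamma(b)}{\Gamma(a+2\mu)\Gamma(b+2\nu)}<1$. Then the function $\mathbb{W}_{(\mu,a),(\nu,b)}(z)$ is convex in $\mathbb{D}_{1/2}$.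
   Context: $\mathbb{D}_{1/2}=\{z\in\mathbb{C}:|z|<1/2\}$. The normalized four parameters Wright function is $$\mathbb{W}_{(\mu,a),(\nu,b)}(z)=\sum_{k=0}^{\infty}\frac{\Gamma(a)\Gamma(b)}{\Gamma(a+k\mu)\Gamma(b+k\nu)}\,z^{k+1}.$$ A function $f$ analytic with $f(0)=0$, $f'(0)=1$ is convex in a disk $D$ centered at $0$ if $f$ is univalent in $D$ and $f(D)$ is a convex domain; equivalently, $\Re\left(1+zf''(z)/f'(z)\right)>0$ for all $z\in D$. *)

(* Defs.v *)
From Stdlib Require Import Reals.
From Coquelicot Require Import Coquelicot.

Open Scope R_scope.

(* Euler's integral; it represents the Gamma function for [0 < x] only. *)
Definition Gamma (x : R) : R :=
  RInt_gen (fun t : R => Rpower t (x - 1) * exp (- t))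
    (at_right 0) (Rbar_locally p_infty).

Definition Wright_coef (mu a nu b : R) (k : nat) : R :=
  (Gamma a * Gamma b) / (Gamma (a + INR k * mu) * Gamma (b + INR k * nu)).

(* Coquelicot has no total sum operator for complex series: as for [RInt_gen],
   [iota] selects the limit of the partial sums in [C] when it exists. *)
Definition Wright (mu a nu b : R) (z : C) : C :=
  @iota C_CompleteNormedModule
    (@is_series C_AbsRing C_NormedModule
       (fun k : nat => (RtoC (Wright_coef mu a nu b k) * z ^ (k + 1))%C)).

Definition disk (r : R) (z : C) : Prop := Cmod z < r.

Definition image (f : C -> C) (D : C -> Prop) (w : C) : Prop :=
  exists z : C, D z /\ w = f z.

Definition convex_set (S : C -> Prop) : Prop :=
  forall (w1 w2 : C) (t : R), S w1 -> S w2 -> 0 <= t <= 1 ->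
    S (RtoC (1 - t) * w1 + RtoC t * w2)%C.

(* On an open set, analytic and complex differentiable mean the same. *)
Definition analytic_on (f : C -> C) (D : C -> Prop) : Prop :=
  forall z : C, D z -> @ex_derive C_AbsRing C_NormedModule f z.

Definition univalent_on (f : C -> C) (D : C -> Prop) : Prop :=
  analytic_on f D /\
  (forall z1 z2 : C, D z1 -> D z2 -> f z1 = f z2 -> z1 = z2).

(* A domain is a nonempty connected open set; convexity implies connectedness. *)
Definition convex_domain (S : C -> Prop) : Prop :=
  (exists w : C, S w) /\ @open C_UniformSpace S /\ convex_set S.

Definition normalized (f : C -> C) : Prop :=
  f (RtoC 0) = RtoC 0 /\
  @is_derive C_AbsRing C_NormedModule f (RtoC 0) (RtoC 1).

Definition convex_in_disk (f : C -> C) (r : R) : Prop :=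
  normalized f /\ univalent_on f (disk r) /\
  convex_domain (image f (disk r)).

(* Main.v *)
(* Euler's integral makes Gamma log-convex, so the coefficients [c k] are
   log-concave. Since e >= 8/3, hypothesis (iii) gives [2 c_1 + 5 c_2 < 1], which
   forces [c_(k+1) / c_k <= 3/10] for [k >= 1] and hence the sum of [(k+1) c_k]
   over [k >= 1] is below 1. As [k + 1 <= 2^k], the sum of
   [(k+1)^2 c_k 2^(-k)] over [k >= 1] is at most 1.

   That coefficient condition implies convexity without any complex function
   theory. For [|z| <= |p|] one has
   [f z - f p = f'(p) (z - p) + T] with [2 |p| |T| <= |f'(p)| |z - p|^2], and
   [2 Re ((z - p) conj p) <= - |z - p|^2], so that
   [Re ((f z - f p) conj (p f'(p))) <= 0]: the image of the disk of radius [|p|]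
   lies in a half-plane supported at [f p]. Moreover [f - id] is 1/2-Lipschitz, so
   after radial retraction onto the disk of radius [rho] every [w] is
   [f p + c p] with [|p| <= rho], [c >= 0], and [c = 0] or [|p| = rho]. If [w]
   is a convex combination of values of [f] on that disk, the half-plane at [f p]
   forces [c = 0], that is, [w = f p]. *)
Require Import Defs.
From Stdlib Require Import Reals Lra Lia.
From Coquelicot Require Import Coquelicot.
Open Scope R_scope.

(** * Plane geometry: the real inner product and projection onto a closed disk *)

Definition Cdot (z w : C) : R := Re (z * Cconj w).

Lemma Cdot_self (z : C) : Cdot z z = Cmod z ^ 2.
Proof. rewrite Cmod2_alt; destruct z; unfold Cdot; simpl; ring. Qed.

Lemma Cdot_le (z w : C) : Cdot z w <= Cmod z * Cmod w.
Proof.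
  unfold Cdot; rewrite <- (Cmod_conj w), <- Cmod_mult.
  apply Rle_trans with (1 := Rle_abs _), re_le_Cmod.
Qed.

Lemma Cmod_sub_sqr (z w : C) :
  Cmod (z - w) ^ 2 = Cmod z ^ 2 + Cmod w ^ 2 - 2 * Cdot z w.
Proof.
  rewrite !Cmod2_alt; destruct z, w; unfold Cdot; simpl; ring.
Qed.

Lemma Cmod_sub_sym (z w : C) : Cmod (z - w) = Cmod (w - z).
Proof. rewrite <- Cmod_opp; f_equal; ring. Qed.

Lemma Cmod_eq_0_sub (z w : C) : Cmod (z - w) <= 0 -> z = w.
Proof.
  intros H.
  assert (E : (z - w)%C = 0).
  { apply Cmod_eq_0, Rle_antisym; [exact H | apply Cmod_ge_0]. }
  replace z with (z - w + w)%C by ring; rewrite E; ring.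
Qed.

Definition radial_retract (rho : R) (z : C) : C :=
  if Rle_dec (Cmod z) rho then z else (RtoC (rho / Cmod z) * z)%C.

(** Later arguments see the retraction only in this form: [z = (1 + c) p], where either [c = 0] or
    [p] lies on the bounding circle. *)
Lemma radial_retract_spec (rho : R) (z : C) : 0 < rho ->
  Cmod (radial_retract rho z) <= rho /\
  exists c, z = (RtoC (1 + c) * radial_retract rho z)%C /\ 0 <= c /\
    (c = 0 \/ Cmod (radial_retract rho z) = rho).
Proof.
  intros Hr; unfold radial_retract; destruct (Rle_dec (Cmod z) rho) as [H | H].
  - split; [exact H |]; exists 0; rewrite Rplus_0_r.
    repeat split; [ring | lra | now left].
  - apply Rnot_le_lt in H.
    assert (E : Cmod (RtoC (rho / Cmod z) * z) = rho).
    { rewrite Cmod_mult, Cmod_R, Rabs_pos_eq; [field; lra |].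
      apply Rlt_le, Rdiv_lt_0_compat; lra. }
    rewrite E; split; [lra |]; exists (Cmod z / rho - 1); repeat split; [| | now right].
    + rewrite Cmult_assoc, <- RtoC_mult.
      replace ((1 + (Cmod z / rho - 1)) * (rho / Cmod z)) with 1 by (field; lra).
      ring.
    + assert (1 < Cmod z / rho); [| lra].
      apply Rmult_lt_reg_r with rho; [lra |].
      unfold Rdiv; rewrite Rmult_assoc, Rinv_l; lra.
Qed.

(* [p] is the nearest point to [z] in the disk, hence the obtuse angle at [p]. *)
Lemma radial_retract_obtuse (rho c : R) (p q : C) : 0 <= c ->
  (c = 0 \/ Cmod p = rho) -> Cmod q <= rho ->
  Cdot (RtoC (1 + c) * p - p) (q - p) <= 0.
Proof.
  intros Hc Hp Hq.
  replace (Cdot (RtoC (1 + c) * p - p) (q - p)) with (c * (Cdot p q - Cdot p p))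
    by (destruct p, q; unfold Cdot; simpl; ring).
  rewrite Cdot_self; destruct Hp as [-> | Hp]; [lra |].
  assert (D := Cdot_le p q); rewrite Hp in D |- *.
  assert (rho * Cmod q <= rho * rho)
    by (apply Rmult_le_compat_l; [rewrite <- Hp; apply Cmod_ge_0 | lra]).
  nra.
Qed.

(** Writing [z] and [w] for the outer points, the obtuse angles at [p] and at [q] add up to
    [|p - q|^2 <= Cdot (z - w) (p - q)]. Cauchy-Schwarz and division by [|p - q|] finish. *)
Lemma radial_retract_nonexpansive (rho c d : R) (p q : C) :
  0 <= c -> (c = 0 \/ Cmod p = rho) -> Cmod p <= rho ->
  0 <= d -> (d = 0 \/ Cmod q = rho) -> Cmod q <= rho ->
  Cmod (p - q) <= Cmod (RtoC (1 + c) * p - RtoC (1 + d) * q).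
Proof.
  intros Hc Hc' Hp Hd Hd' Hq.
  assert (O1 := radial_retract_obtuse rho c p q Hc Hc' Hq).
  assert (O2 := radial_retract_obtuse rho d q p Hd Hd' Hp).
  set (z := (RtoC (1 + c) * p)%C) in *; set (w := (RtoC (1 + d) * q)%C) in *.
  assert (D := Cdot_le (z - w) (p - q)).
  assert (E : Cdot (z - w) (p - q) =
    Cmod (p - q) ^ 2 - Cdot (z - p) (q - p) - Cdot (w - q) (p - q)).
  { rewrite Cmod2_alt; destruct z, w, p, q; unfold Cdot; simpl; ring. }
  destruct (Req_dec (Cmod (p - q)) 0) as [-> | Hn]; [apply Cmod_ge_0 |].
  apply Rmult_le_reg_r with (Cmod (p - q)).
  - assert (P := Cmod_ge_0 (p - q)); lra.
  - lra.
Qed.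

(** * Banach's fixed point theorem and a criterion for complex differentiability *)

(** The increments of the Picard iterates are dominated by a geometric series, so completeness of
    [C] enters as absolute convergence of a telescoping series, whose sum is the fixed point. *)
Lemma contraction_fixed_point (T : C -> C) (q : R) : 0 <= q < 1 ->
  (forall z w, Cmod (T z - T w) <= q * Cmod (z - w)) -> exists z, T z = z.
Proof.
  intros Hq HT.
  set (x := fix x n := match n with O => RtoC 0 | S m => T (x m) end).
  assert (Hgeo : forall n, Cmod (x (S n) - x n) <= Cmod (x 1%nat - x 0%nat) * q ^ n).
  { induction n as [| n IH]; [simpl pow; lra |].
    apply Rle_trans with (1 := HT (x (S n)) (x n)); simpl pow.
    apply (Rmult_le_compat_l q) in IH; lra. }
  destruct (@ex_series_le C_AbsRing C_CompleteNormedModule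
    (fun n => (x (S n) - x n)%C) (fun n => Cmod (x 1%nat - x 0%nat) * q ^ n))
    as [l Hl].
  - exact Hgeo.
  - apply (@ex_series_scal_l R_AbsRing), ex_series_geom.
    rewrite Rabs_pos_eq; lra.
  - exists l; apply Cmod_eq_0_sub, le_epsilon; intros e He; rewrite Rplus_0_l.
    (* The sum telescopes to [x (S n) - x 0], and [x 0 = 0]. *)
    assert (Hsum : forall n, @sum_n C_AbelianMonoid (fun n => (x (S n) - x n)%C) n = x (S n)).
    { induction n as [| n IH]; [rewrite sum_O; simpl; ring |].
      rewrite sum_Sn, IH; change (x (S n) + (x (S (S n)) - x (S n)) = x (S (S n)))%C; ring. }
    assert (Hev : eventually (fun n => Cmod (x (S n) - l) < e / 2)).
    { assert (L := Hl (fun y => Cmod (y - l) < e / 2)).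
      destruct L as [N HN].
      - apply (@locally_le_locally_norm C_AbsRing C_NormedModule).
        exists (mkposreal (e / 2) ltac:(lra)); intros y Hy; exact Hy.
      - exists N; intros n Hn; rewrite <- Hsum; now apply HN. }
    destruct Hev as [N HN].
    assert (A := HN N (Nat.le_refl N)); assert (B := HN (S N) ltac:(lia)).
    change (x (S (S N))) with (T (x (S N))) in B.
    assert (D := HT l (x (S N))); rewrite (Cmod_sub_sym l) in D.
    replace (T l - l)%C with ((T l - T (x (S N))) + (T (x (S N)) - l))%C by ring.
    apply Rle_trans with (1 := Cmod_triangle _ _).
    assert (P := Cmod_ge_0 (x (S N) - l)).
    nra.
Qed.

Lemma is_derive_of_quadratic_remainder (f : C -> C) (z l : C) (K d : R) : 0 < d ->
  (forall y, Cmod (y - z) < d ->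
    Cmod (f y - f z - l * (y - z)) <= K * Cmod (y - z) ^ 2) ->
  @is_derive C_AbsRing C_NormedModule f z l.
Proof.
  intros Hd HK; split; [apply is_linear_scal_l |].
  intros x Hx.
  apply (@is_filter_lim_locally_unique C_AbsRing (AbsRing_NormedModule C_AbsRing)) in Hx.
  subst x; intros [e He].
  (* [Rabs K + 1] is a positive bound for [K], whose sign is unrestricted. *)
  assert (HM : 0 < Rabs K + 1) by (assert (P := Rabs_pos K); lra).
  assert (He' : 0 < e / (Rabs K + 1)) by now apply Rdiv_lt_0_compat.
  exists (mkposreal (Rmin d (e / (Rabs K + 1))) (Rmin_pos _ _ Hd He')).
  intros y Hy; change (Cmod (y - z) < Rmin d (e / (Rabs K + 1))) in Hy.
  change (Cmod (f y - f z - (y - z) * l) <= e * Cmod (y - z)).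
  rewrite (Cmult_comm _ l).
  apply Rle_trans with (1 := HK y (Rlt_le_trans _ _ _ Hy (Rmin_l _ _))).
  assert (H2 := Rlt_le_trans _ _ _ Hy (Rmin_r _ _)).
  assert (P := Cmod_ge_0 (y - z)).
  replace (K * Cmod (y - z) ^ 2) with (K * Cmod (y - z) * Cmod (y - z)) by ring.
  apply Rmult_le_compat_r; [exact P |].
  apply Rle_trans with ((Rabs K + 1) * Cmod (y - z)).
  - apply Rmult_le_compat_r; [exact P |].
    assert (Q := Rle_abs K); lra.
  - apply (Rmult_lt_compat_l _ _ _ HM), Rlt_le in H2.
    replace ((Rabs K + 1) * (e / (Rabs K + 1))) with e in H2 by (field; lra).
    exact H2.
Qed.

(** * Euler's integral: convergence, positivity and log-convexity of [Gamma] *)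

(** The limit is the supremum [l] of the integrals over compact subintervals: once one of them
    exceeds [l - eps], nonnegativity of [f] keeps the integral over every larger interval between
    [l - eps] and [l]. *)
Lemma is_RInt_gen_pos_bounded (f : R -> R) (M : R) :
  (forall t, 0 < t -> 0 <= f t) -> (forall t, 0 < t -> continuous f t) ->
  (forall u v, 0 < u < v -> RInt f u v <= M) ->
  exists l, is_RInt_gen f (at_right 0) (Rbar_locally p_infty) l /\
    (forall u v, 0 < u < v -> RInt f u v <= l).
Proof.
  intros Hpos Hcont HM.
  assert (Hex : forall u v, 0 < u -> 0 < v -> ex_RInt f u v).
  { intros u v Hu Hv; apply (@ex_RInt_continuous R_CompleteNormedModule); intros t [Ht _].
    apply Hcont; apply Rlt_le_trans with (2 := Ht); now apply Rmin_pos. }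
  set (E := fun y => exists u v, 0 < u < v /\ y = RInt f u v).
  destruct (completeness E) as [l [Hub Hlub]].
  { exists M; intros y (u & v & Huv & ->); now apply HM. }
  { exists (RInt f 1 2), 1, 2; split; [lra | easy]. }
  assert (Hle : forall u v, 0 < u < v -> RInt f u v <= l).
  { intros u v Huv; apply Hub; now exists u, v. }
  exists l; split; [| exact Hle].
  apply filterlimi_locally; intros eps.
  destruct (Classical_Prop.classic
    (exists u v, 0 < u < v /\ l - eps < RInt f u v)) as [(u0 & v0 & H0 & Hl) | Hn].
  2: { exfalso; apply (Rlt_not_le l (l - eps)); [destruct eps; simpl; lra |].
    apply Hlub; intros y (u & v & Huv & ->).
    apply Rnot_lt_le; intros Hlt; apply Hn; now exists u, v. }
  apply Filter_prod with (Q := fun u => 0 < u < u0) (R := fun v => v0 < v).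
  - exists (mkposreal u0 (proj1 H0)); intros y Hy Hy0.
    change (Rabs (y - 0) < u0) in Hy.
    rewrite Rminus_0_r, Rabs_pos_eq in Hy; lra.
  - now exists v0.
  - intros u v Hu Hv; exists (RInt f u v); split.
    + apply (@RInt_correct R_CompleteNormedModule), Hex; simpl; lra.
    + change (Rabs (RInt f u v - l) < eps).
      assert (H1 := Hle u v ltac:(lra)).
      assert (A : RInt f u v = RInt f u u0 + RInt f u0 v0 + RInt f v0 v).
      { rewrite <- (RInt_Chasles f u v0 v), <- (RInt_Chasles f u u0 v0); try easy;
          apply Hex; lra. }
      assert (B : 0 <= RInt f u u0).
      { apply RInt_ge_0; [lra | apply Hex; lra | intros; apply Hpos; lra]. }
      assert (D : 0 <= RInt f v0 v).
      { apply RInt_ge_0; [lra | apply Hex; lra | intros; apply Hpos; lra]. }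
      apply Rabs_def1; lra.
Qed.

Lemma exp_le_compat (x y : R) : x <= y -> exp x <= exp y.
Proof.
  intros [H | ->]; [left; now apply exp_increasing | apply Rle_refl].
Qed.

(** Provides the constant in the majorant of the Gamma integrand. [(1 + y)^2 <= 2 + 2 y^2] leaves
    [t^(2x) e^(-t)], maximal at [t = 2x]; it is bounded through [ln y <= y - 1] at
    [y = t / (2x)]. *)
Lemma Rpower_sqr_exp_bound (x t : R) : 0 < x -> 0 < t ->
  (1 + Rpower t x) ^ 2 * exp (- t) <= 2 + 2 * Rpower (2 * x) (2 * x).
Proof.
  intros Hx Ht.
  assert (Hln : ln (t / (2 * x)) <= t / (2 * x) - 1).
  { assert (P : 0 < t / (2 * x)) by (apply Rdiv_lt_0_compat; lra).
    assert (E := exp_ineq1_le (ln (t / (2 * x)))).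
    rewrite exp_ln in E; lra. }
  rewrite ln_div in Hln by lra.
  assert (Hm : 2 * x * ln t - t <= 2 * x * ln (2 * x)).
  { apply (Rmult_le_compat_l (2 * x)) in Hln; [| lra].
    replace (2 * x * (t / (2 * x) - 1)) with (t - 2 * x) in Hln by (field; lra).
    lra. }
  assert (Hp : Rpower t x ^ 2 * exp (- t) <= Rpower (2 * x) (2 * x)).
  { unfold Rpower; simpl; rewrite Rmult_1_r, <- !exp_plus.
    apply exp_le_compat; lra. }
  assert (He : exp (- t) <= 1) by (rewrite <- exp_0; apply exp_le_compat; lra).
  assert (0 < exp (- t)) by apply exp_pos.
  assert (Hs : (1 + Rpower t x) ^ 2 <= 2 + 2 * Rpower t x ^ 2).
  { assert (0 <= (1 - Rpower t x) ^ 2) by apply pow2_ge_0; nra. }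
  apply (Rmult_le_compat_r (exp (- t))) in Hs; nra.
Qed.

Lemma continuous_Gamma_integrand (x t : R) : 0 < t ->
  continuous (fun t => Rpower t (x - 1) * exp (- t)) t.
Proof.
  intros Ht; apply (@ex_derive_continuous R_AbsRing R_NormedModule).
  unfold Rpower; auto_derive; lra.
Qed.

(** One majorant serves both ends: [t^(x-1) / (1 + t^x)^2] behaves like [t^(x-1)] at 0 and like
    [t^(-x-1)] at infinity, and it integrates explicitly. *)
Lemma is_RInt_gen_Gamma (x : R) : 0 < x ->
  is_RInt_gen (fun t => Rpower t (x - 1) * exp (- t))
    (at_right 0) (Rbar_locally p_infty) (Gamma x) /\ 0 < Gamma x.
Proof.
  intros Hx.
  set (f := fun t => Rpower t (x - 1) * exp (- t)).
  set (K := 2 + 2 * Rpower (2 * x) (2 * x)).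
  set (g := fun t => K * (Rpower t (x - 1) / (1 + Rpower t x) ^ 2)).
  assert (Pp : forall s y, 0 < Rpower s y) by (intros; apply exp_pos).
  assert (HK : 0 < K) by (unfold K; specialize (Pp (2 * x) (2 * x)); lra).
  assert (Hfpos : forall t, 0 < f t)
    by (intros t; apply Rmult_lt_0_compat; [apply Pp | apply exp_pos]).
  assert (Hfg : forall t, 0 < t -> f t <= g t).
  { intros t Ht; unfold f, g.
    assert (B := Rpower_sqr_exp_bound x t Hx Ht); fold K in B.
    assert (P := Pp t x); assert (P1 := Pp t (x - 1)).
    apply Rmult_le_reg_r with ((1 + Rpower t x) ^ 2); [apply pow_lt; lra |].
    replace (K * (Rpower t (x - 1) / (1 + Rpower t x) ^ 2) * (1 + Rpower t x) ^ 2)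
      with (Rpower t (x - 1) * K) by (field; lra).
    rewrite Rmult_assoc; apply Rmult_le_compat_l; [lra |].
    rewrite Rmult_comm; exact B. }
  (* [g] has the bounded primitive [- K / (x (1 + t^x))]. *)
  assert (HG : forall t, 0 < t ->
    is_derive (fun t => - K / x / (1 + Rpower t x)) t (g t)).
  { intros t Ht; assert (P := Pp t x); unfold g.
    replace (Rpower t (x - 1)) with (Rpower t x / t).
    2: { unfold Rminus; rewrite Rpower_plus, Rpower_Ropp, Rpower_1 by lra; easy. }
    unfold Rpower in *; auto_derive; [repeat split; lra | field; lra]. }
  assert (Hgc : forall t, 0 < t -> continuous g t).
  { intros t Ht; apply (@ex_derive_continuous R_AbsRing R_NormedModule).
    assert (P := Pp t x); unfold g, Rpower in *; auto_derive; repeat split; try lra.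
    rewrite Rmult_1_r; apply Rgt_not_eq; nra. }
  destruct (is_RInt_gen_pos_bounded f (K / x)) as [l [Hl Hub]].
  - intros; apply Rlt_le, Hfpos.
  - intros; now apply continuous_Gamma_integrand.
  - intros u v Huv.
    assert (HI : is_RInt g u v
      (- K / x / (1 + Rpower v x) - (- K / x / (1 + Rpower u x)))).
    { apply (@is_RInt_derive R_CompleteNormedModule
        (fun t => - K / x / (1 + Rpower t x)) g);
        intros t; rewrite Rmin_left, Rmax_right by lra; intros Ht;
        [apply HG | apply Hgc]; lra. }
    apply Rle_trans with (1 := is_RInt_le f g u v _ _ ltac:(lra)
      (@RInt_correct R_CompleteNormedModule f u v
        (@ex_RInt_continuous R_CompleteNormedModule f u v
        ltac:(intros t; rewrite Rmin_left, Rmax_right by lra; intros Ht;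
              apply continuous_Gamma_integrand; lra)))
      HI ltac:(intros t Ht; apply Hfg; lra)).
    assert (Pu := Pp u x); assert (Pv := Pp v x).
    assert (Hi : forall p, 0 < p -> 0 < / (1 + p) < 1).
    { intros p Hp; split; [apply Rinv_0_lt_compat; lra |].
      rewrite <- Rinv_1; apply Rinv_lt_contravar; lra. }
    assert (I1 := Hi _ Pu); assert (I2 := Hi _ Pv).
    assert (0 < K / x) by now apply Rdiv_lt_0_compat.
    replace (- K / x / (1 + Rpower v x) - - K / x / (1 + Rpower u x))
      with (K / x * (/ (1 + Rpower u x) - / (1 + Rpower v x))) by (field; lra).
    nra.
  - assert (E : Gamma x = l).
    { apply is_RInt_gen_unique; exact Hl. }
    rewrite E; split; [exact Hl |].
    (* Positivity: the whole integral dominates the one over [[1, 2]]. *)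
    apply Rlt_le_trans with (2 := Hub 1 2 ltac:(lra)).
    apply RInt_gt_0; [lra | intros; apply Hfpos |].
    intros t Ht; apply continuous_Gamma_integrand; lra.
Qed.

Lemma Gamma_pos (x : R) : 0 < x -> 0 < Gamma x.
Proof. intros Hx; now apply is_RInt_gen_Gamma. Qed.

(* Integrate [t^(x-1) e^(-t) (s - t^h)^2 >= 0], a quadratic polynomial in [s]. *)
Lemma Gamma_log_convex (x h : R) : 0 < x -> 0 < h ->
  Gamma (x + h) ^ 2 <= Gamma x * Gamma (x + 2 * h).
Proof.
  intros Hx Hh.
  destruct (is_RInt_gen_Gamma x Hx) as [I0 P0].
  destruct (is_RInt_gen_Gamma (x + h) ltac:(lra)) as [I1 P1].
  destruct (is_RInt_gen_Gamma (x + 2 * h) ltac:(lra)) as [I2 P2].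
  (* This [s] minimizes the quadratic, so nonnegativity there is the discriminant inequality. *)
  set (s := Gamma (x + h) / Gamma x).
  assert (HI := is_RInt_gen_plus _ _ _ _
    (is_RInt_gen_plus _ _ _ _ (is_RInt_gen_scal _ (s ^ 2) _ I0)
       (is_RInt_gen_scal _ (- 2 * s) _ I1)) I2).
  (* Taking the integrand as its own majorant yields [|I| <= I], hence [0 <= I], for its integral
     [I]. *)
  apply RInt_gen_norm with (3 := HI) in HI.
  - change (Rabs (s ^ 2 * Gamma x + - 2 * s * Gamma (x + h) + Gamma (x + 2 * h)) <=
      s ^ 2 * Gamma x + - 2 * s * Gamma (x + h) + Gamma (x + 2 * h)) in HI.
    assert (Q := Rle_trans _ _ _ (Rabs_pos _) HI).
    apply (Rmult_le_compat_l (Gamma x)) in Q; [| lra].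
    unfold s in Q.
    replace (Gamma x * ((Gamma (x + h) / Gamma x) ^ 2 * Gamma x +
      - 2 * (Gamma (x + h) / Gamma x) * Gamma (x + h) + Gamma (x + 2 * h)))
      with (Gamma x * Gamma (x + 2 * h) - Gamma (x + h) ^ 2) in Q by (field; lra).
    lra.
  - apply Filter_prod with (Q := fun u => u < 1) (R := fun v => 1 < v).
    + exists (mkposreal 1 Rlt_0_1); intros y Hy Hy0.
      change (Rabs (y - 0) < 1) in Hy; apply Rabs_def2 in Hy; lra.
    + now exists 1.
    + simpl; intros; lra.
  - apply Filter_prod with (Q := fun u => 0 < u) (R := fun v => 1 < v).
    + exists (mkposreal 1 Rlt_0_1); intros y Hy Hy0; exact Hy0.
    + now exists 1.
    + simpl; intros u v Hu Hv t Ht.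
      assert (Et : 0 < t) by lra.
      unfold plus, scal; simpl; unfold mult; simpl.
      change (Rabs (s ^ 2 * (Rpower t (x - 1) * exp (- t)) +
        - 2 * s * (Rpower t (x + h - 1) * exp (- t)) +
        Rpower t (x + 2 * h - 1) * exp (- t)) <=
        s ^ 2 * (Rpower t (x - 1) * exp (- t)) +
        - 2 * s * (Rpower t (x + h - 1) * exp (- t)) +
        Rpower t (x + 2 * h - 1) * exp (- t)).
      replace (x + h - 1) with (x - 1 + h) by ring.
      replace (x + 2 * h - 1) with (x - 1 + h + h) by ring.
      rewrite !Rpower_plus.
      replace (s ^ 2 * (Rpower t (x - 1) * exp (- t)) +
        - 2 * s * (Rpower t (x - 1) * Rpower t h * exp (- t)) +
        Rpower t (x - 1) * Rpower t h * Rpower t h * exp (- t))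
        with (Rpower t (x - 1) * exp (- t) * (s - Rpower t h) ^ 2) by ring.
      rewrite Rabs_pos_eq; [lra |].
      apply Rmult_le_pos; [| apply pow2_ge_0].
      apply Rmult_le_pos; apply Rlt_le, exp_pos.
Qed.

(** * Maps close to the identity: solvability up to retraction, open and convex images *)

(* Banach's theorem applied to [w - (f - id)], with [f - id] extended to the
   whole plane by radial retraction. *)
Lemma near_identity_retracted_surjective (f : C -> C) (rho : R) : 0 < rho ->
  (forall z w, Cmod z <= rho -> Cmod w <= rho ->
    Cmod (f z - f w - (z - w)) <= / 2 * Cmod (z - w)) ->
  forall w, exists p c, w = (f p + RtoC c * p)%C /\ Cmod p <= rho /\ 0 <= c /\
    (c = 0 \/ Cmod p = rho).
Proof.
  intros Hr Hlip w.
  destruct (contraction_fixed_point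
    (fun z => w - (f (radial_retract rho z) - radial_retract rho z))%C (/ 2))
    as [z Hz]; [lra | |].
  - intros z1 z2.
    destruct (radial_retract_spec rho z1 Hr) as [H1 (c1 & E1 & P1 & Q1)].
    destruct (radial_retract_spec rho z2 Hr) as [H2 (c2 & E2 & P2 & Q2)].
    set (p1 := radial_retract rho z1) in *; set (p2 := radial_retract rho z2) in *.
    replace (w - (f p1 - p1) - (w - (f p2 - p2)))%C
      with (- (f p1 - f p2 - (p1 - p2)))%C by ring.
    rewrite Cmod_opp; apply Rle_trans with (1 := Hlip p1 p2 H1 H2).
    apply Rmult_le_compat_l; [lra |].
    rewrite E1, E2; now apply radial_retract_nonexpansive with rho.
  - destruct (radial_retract_spec rho z Hr) as [H1 (c & E & Pc & Qc)].
    (* With [z = (1 + c) p], the fixed-point equation [w - (f p - p) = z] reads [w = f p + c p]. *)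
    exists (radial_retract rho z), c; repeat split; trivial.
    set (p := radial_retract rho z) in *.
    replace w with (w - (f p - p) + f p - p)%C by ring.
    rewrite Hz, E, RtoC_plus; ring.
Qed.

(** For [w = f p + c p], nonexpansiveness and the Lipschitz bound give [|p - z0| <= 2 |w - f z0|].
    Hence if [w] is closer to [f z0] than half of [r - |z0|], then [|p| < r], which forces
    [c = 0]. *)
Lemma near_identity_image_open (f : C -> C) (r : R) : 0 < r ->
  (forall z w, Cmod z <= r -> Cmod w <= r ->
    Cmod (f z - f w - (z - w)) <= / 2 * Cmod (z - w)) ->
  @open C_UniformSpace (image f (disk r)).
Proof.
  intros Hr Hlip w0 (z0 & Hz0 & ->); unfold disk in Hz0.
  apply (@locally_le_locally_norm C_AbsRing C_NormedModule).
  exists (mkposreal ((r - Cmod z0) / 2) ltac:(lra)); intros w Hw.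
  change (Cmod (w - f z0) < (r - Cmod z0) / 2) in Hw.
  destruct (near_identity_retracted_surjective f r Hr Hlip w)
    as (p & c & E & Hp & Hc & Hc').
  assert (N := radial_retract_nonexpansive r c 0 p z0 Hc Hc' Hp
    (Rle_refl 0) (or_introl eq_refl) ltac:(lra)).
  assert (L := Hlip z0 p ltac:(lra) Hp).
  replace (RtoC (1 + c) * p - RtoC (1 + 0) * z0)%C
    with (w - f z0 + (f z0 - f p - (z0 - p)))%C in N
    by (rewrite E, !RtoC_plus; ring).
  apply Rle_trans with (2 := Cmod_triangle _ _) in N.
  rewrite (Cmod_sub_sym z0 p) in L.
  assert (T := Cmod_triangle z0 (p - z0)).
  replace (z0 + (p - z0))%C with p in T by ring.
  exists p; split; [unfold disk; lra |].
  destruct Hc' as [-> | Hc']; [rewrite E; ring | lra].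
Qed.

Lemma near_identity_image_convex (f D : C -> C) (r : R) : 0 < r ->
  (forall z w, Cmod z <= r -> Cmod w <= r ->
    Cmod (f z - f w - (z - w)) <= / 2 * Cmod (z - w)) ->
  (forall w, Cmod w <= r -> Cmod (D w - 1) <= / 2) ->
  (forall z w, Cmod z <= Cmod w <= r ->
    2 * (Cmod w * Cmod (f z - f w - D w * (z - w))) <= Cmod (D w) * Cmod (z - w) ^ 2) ->
  convex_set (image f (disk r)).
Proof.
  intros Hr Hlip HD Hsupp w1 w2 t (z1 & H1 & ->) (z2 & H2 & ->) Ht.
  unfold disk in H1, H2.
  (* A closed disk inside the open one that contains both points; [r / 2] keeps [rho] positive when
     both are 0. *)
  set (rho := Rmax (Rmax (Cmod z1) (Cmod z2)) (r / 2)).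
  assert (Hrho : 0 < rho < r).
  { split; [apply Rlt_le_trans with (2 := Rmax_r _ _); lra |].
    repeat apply Rmax_lub_lt; lra. }
  assert (R1 : Cmod z1 <= rho)
    by (apply Rle_trans with (2 := Rmax_l _ _), Rmax_l).
  assert (R2 : Cmod z2 <= rho)
    by (apply Rle_trans with (2 := Rmax_l _ _), Rmax_r).
  destruct (near_identity_retracted_surjective f rho (proj1 Hrho)
    ltac:(intros; apply Hlip; lra) (RtoC (1 - t) * f z1 + RtoC t * f z2)%C)
    as (p & c & E & Hp & Hc & Hc').
  exists p; split; [unfold disk; lra |].
  destruct Hc' as [-> | Hc']; [rewrite E; ring |].
  (* [p D(p)] is an outer normal at [f p] to the image of the closed disk. *)
  assert (S : forall z, Cmod z <= rho -> Cdot (f z - f p) (p * D p) <= 0).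
  { intros z Hz.
    set (T := (f z - f p - D p * (z - p))%C).
    assert (ET := Hsupp z p ltac:(lra)); fold T in ET.
    replace (Cdot (f z - f p) (p * D p))
      with (Cdot (z - p) p * Cmod (D p) ^ 2 + Cdot T (p * D p)).
    2: { rewrite Cmod2_alt; unfold T; destruct (f z), (f p), (D p), z, p.
      unfold Cdot; simpl; ring. }
    assert (B := Cdot_le T (p * D p)); rewrite Cmod_mult in B.
    assert (A : Cdot (z - p) p <= - Cmod (z - p) ^ 2 / 2).
    { assert (F := Cmod_sub_sqr z p).
      replace (Cdot (z - p) p) with (Cdot z p - Cdot p p)
        by (destruct z, p; unfold Cdot; simpl; ring).
      rewrite Cdot_self.
      assert (Cmod z ^ 2 <= Cmod p ^ 2)
        by (apply pow_incr; split; [apply Cmod_ge_0 | lra]).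
      lra. }
    apply (Rmult_le_compat_r (Cmod (D p) ^ 2)) in A; [| apply pow2_ge_0].
    apply (Rmult_le_compat_l (Cmod (D p))) in ET; [| apply Cmod_ge_0].
    nra. }
  (* The convex combination minus [f p] is [c p], so averaging the two half-plane inequalities gives
     [c |p|^2 Re (D p) <= 0], while [Re (D p) > 0]. *)
  assert (S1 := S z1 R1); assert (S2 := S z2 R2).
  assert (S3 : Cdot (RtoC c * p) (p * D p) <= 0).
  { replace (RtoC c * p)%C
      with (RtoC (1 - t) * f z1 + RtoC t * f z2 - f p)%C by (rewrite E; ring).
    replace (Cdot (RtoC (1 - t) * f z1 + RtoC t * f z2 - f p) (p * D p))
      with ((1 - t) * Cdot (f z1 - f p) (p * D p) + t * Cdot (f z2 - f p) (p * D p))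
      by (destruct (f z1), (f z2), (f p), (D p), p; unfold Cdot; simpl; ring).
    nra. }
  replace (Cdot (RtoC c * p) (p * D p)) with (c * (Cmod p ^ 2 * Re (D p))) in S3
    by (rewrite Cmod2_alt; destruct (D p), p; unfold Cdot; simpl; ring).
  assert (HRe : 0 < Re (D p)).
  { assert (B := re_le_Cmod (D p - 1)); assert (B' := HD p ltac:(lra)).
    replace (Re (D p - 1)) with (Re (D p) - 1) in B by (destruct (D p); simpl; ring).
    assert (B2 := Rle_abs (- (Re (D p) - 1))); rewrite Rabs_Ropp in B2; lra. }
  assert (0 < Cmod p ^ 2 * Re (D p)).
  { apply Rmult_lt_0_compat; [apply pow_lt; lra | exact HRe]. }
  assert (c = 0) as -> by nra.
  rewrite E; ring.
Qed.

(** Separates geometry from power series. The Lipschitz estimate gives injectivity; the one with [K]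
    gives differentiability, which the last estimate cannot, being restricted to [|z| <= |w|] and
    void at [w = 0]. *)
Lemma convex_in_disk_of_estimates (f D : C -> C) (r K : R) : 0 < r ->
  f 0 = 0 -> D 0 = 1 ->
  (forall z w, Cmod z <= r -> Cmod w <= r ->
    Cmod (f z - f w - (z - w)) <= / 2 * Cmod (z - w)) ->
  (forall w, Cmod w <= r -> Cmod (D w - 1) <= / 2) ->
  (forall z w, Cmod z <= r -> Cmod w <= r ->
    Cmod (f z - f w - D w * (z - w)) <= K * Cmod (z - w) ^ 2) ->
  (forall z w, Cmod z <= Cmod w <= r ->
    2 * (Cmod w * Cmod (f z - f w - D w * (z - w))) <= Cmod (D w) * Cmod (z - w) ^ 2) ->
  convex_in_disk f r.
Proof.
  intros Hr Hf0 HD0 Hlip HD HK Hsupp.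
  assert (Hder : forall z, Cmod z < r -> @is_derive C_AbsRing C_NormedModule f z (D z)).
  { intros z Hz; apply is_derive_of_quadratic_remainder with K (r - Cmod z); [lra |].
    intros y Hy; apply HK; [| lra].
    assert (T := Cmod_triangle z (y - z)).
    replace (z + (y - z))%C with y in T by ring; lra. }
  assert (H0 : Cmod 0 < r) by (rewrite Cmod_0; exact Hr).
  split; [| split].
  - split; [exact Hf0 |]; rewrite <- HD0; now apply Hder.
  - split; [intros z Hz; exists (D z); now apply Hder |].
    unfold disk; intros z1 z2 H1 H2 E.
    assert (L := Hlip z1 z2 ltac:(lra) ltac:(lra)).
    replace (f z1 - f z2 - (z1 - z2))%C with (- (z1 - z2))%C in L by (rewrite E; ring).
    rewrite Cmod_opp in L; apply Cmod_eq_0_sub; lra.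
  - split; [exists (f 0), 0; now split |].
    split; [now apply near_identity_image_open |].
    now apply near_identity_image_convex with D.
Qed.

(** * Power series: termwise estimates and the coefficient criterion for convexity *)

Lemma is_series_norm_le {K : AbsRing} {V : NormedModule K}
  (u : nat -> V) (v : nat -> R) (l : V) (s : R) :
  (forall n, norm (u n) <= v n) -> is_series u l -> is_series v s -> norm l <= s.
Proof.
  intros Huv Hu Hv.
  apply (filterlim_le (F := eventually)
    (fun n => norm (sum_n u n)) (sum_n v) (Finite (norm l)) (Finite s)).
  - exists 0%nat; intros n _; unfold sum_n.
    apply Rle_trans with (1 := norm_sum_n_m _ _ _); now apply sum_n_m_le.
  - apply filterlim_comp with (2 := filterlim_norm l); exact Hu.
  - exact Hv.
Qed.

Lemma is_series_Cmod_le (u : nat -> C) (v : nat -> R) (l : C) (s : R) :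
  (forall n, Cmod (u n) <= v n) -> @is_series C_AbsRing C_NormedModule u l ->
  is_series v s -> Cmod l <= s.
Proof. exact (is_series_norm_le u v l s). Qed.

Lemma Cpow_sub_bound (z w : C) (rho : R) (n : nat) :
  Cmod z <= rho -> Cmod w <= rho ->
  Cmod (z ^ S n - w ^ S n) <= INR (S n) * rho ^ n * Cmod (z - w).
Proof.
  intros Hz Hw; induction n as [| n IH].
  - simpl Cpow; simpl INR; simpl pow.
    replace (z * 1 - w * 1)%C with (z - w)%C by ring; lra.
  - replace (z ^ S (S n) - w ^ S (S n))%C
      with (z * (z ^ S n - w ^ S n) + w ^ S n * (z - w))%C by (simpl; ring).
    apply Rle_trans with (1 := Cmod_triangle _ _).
    rewrite !Cmod_mult, Cmod_pow, (S_INR (S n)).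
    assert (P : Cmod w ^ S n <= rho ^ S n)
      by (apply pow_incr; split; [apply Cmod_ge_0 | lra]).
    apply (Rmult_le_compat_r (Cmod (z - w))) in P; [| apply Cmod_ge_0].
    assert (Q : Cmod z * Cmod (z ^ S n - w ^ S n) <=
      rho * (INR (S n) * rho ^ n * Cmod (z - w)))
      by (apply Rmult_le_compat; trivial; apply Cmod_ge_0).
    simpl pow in *; lra.
Qed.

(* The factor [rho] on the left avoids the power [rho^(n-1)], junk at [n = 0]. *)
Lemma Cpow_taylor_bound (z w : C) (rho : R) (n : nat) :
  Cmod z <= rho -> Cmod w <= rho ->
  rho * Cmod (z ^ S n - w ^ S n - RtoC (INR (S n)) * w ^ n * (z - w)) <=
    INR (S n) * INR n / 2 * rho ^ n * Cmod (z - w) ^ 2.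
Proof.
  intros Hz Hw.
  assert (Hr : 0 <= rho) by (apply Rle_trans with (1 := Cmod_ge_0 z), Hz).
  induction n as [| n IH].
  - replace (z ^ 1 - w ^ 1 - RtoC (INR 1) * w ^ 0 * (z - w))%C with (RtoC 0)
      by (simpl; ring).
    rewrite Cmod_0; simpl; lra.
  - replace (z ^ S (S n) - w ^ S (S n) - RtoC (INR (S (S n))) * w ^ S n * (z - w))%C
      with (w * (z ^ S n - w ^ S n - RtoC (INR (S n)) * w ^ n * (z - w)) +
            (z - w) * (z ^ S n - w ^ S n))%C
      by (rewrite (S_INR (S n)), RtoC_plus; simpl Cpow; ring).
    set (T := (z ^ S n - w ^ S n - RtoC (INR (S n)) * w ^ n * (z - w))%C) in *.
    assert (A := Cmod_triangle (w * T) ((z - w) * (z ^ S n - w ^ S n))).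
    rewrite !Cmod_mult in A.
    assert (B := Cpow_sub_bound z w rho n Hz Hw).
    apply (Rmult_le_compat_l (Cmod (z - w))) in B; [| apply Cmod_ge_0].
    assert (D : Cmod w * Cmod T <= rho * Cmod T)
      by (apply Rmult_le_compat_r; [apply Cmod_ge_0 | exact Hw]).
    apply Rle_trans with (rho * (INR (S n) * INR n / 2 * rho ^ n * Cmod (z - w) ^ 2 +
      Cmod (z - w) * (INR (S n) * rho ^ n * Cmod (z - w)))).
    + apply Rmult_le_compat_l; [exact Hr | lra].
    (* The coefficients add up: [(n+1) n / 2 + (n+1) = (n+2) (n+1) / 2]. *)
    + apply Req_le; rewrite !S_INR; simpl pow; field.
Qed.

Lemma iota_is_series (u : nat -> C) :
  @ex_series C_AbsRing C_NormedModule u ->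
  @is_series C_AbsRing C_NormedModule u
    (@iota C_CompleteNormedModule (@is_series C_AbsRing C_NormedModule u)).
Proof.
  intros [l Hl].
  assert (E : @iota C_CompleteNormedModule (@is_series C_AbsRing C_NormedModule u) = l).
  { apply (@iota_filterlim_locally C_AbsRing C_CompleteNormedModule); [| exact Hl].
    apply Proper_StrongProper, eventually_filter. }
  rewrite E; exact Hl.
Qed.

Lemma is_series_C_tail (u : nat -> C) (l : C) :
  @is_series C_AbsRing C_NormedModule u l ->
  @is_series C_AbsRing C_NormedModule (fun k => u (S k)) (l - u 0%nat)%C.
Proof.
  intros H; apply (@is_series_incr_1 C_AbsRing C_NormedModule).
  change (@is_series C_AbsRing C_NormedModule u (l - u 0%nat + u 0%nat)%C).
  replace (l - u 0%nat + u 0%nat)%C with l by ring; exact H.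
Qed.

(* Since [n^2 >= 2 n] for [n >= 2], the hypothesis also controls [f' - 1] by [1/2]. *)
Lemma convex_in_disk_of_coefficients (alpha : nat -> C) (f : C -> C) (r s : R) :
  0 < r -> alpha 0%nat = 1 ->
  (forall z, Cmod z <= r ->
    @is_series C_AbsRing C_NormedModule (fun k => alpha k * z ^ (k + 1))%C (f z)) ->
  is_series (fun k => INR (S (S k)) ^ 2 * Cmod (alpha (S k)) * r ^ S k) s ->
  s <= 1 -> convex_in_disk f r.
Proof.
  intros Hr Ha0 Hf Hs Hs1.
  set (v := fun k => INR (S (S k)) ^ 2 * Cmod (alpha (S k)) * r ^ S k) in Hs.
  (* [alpha k] multiplies [z^(k+1)], so [n k = k + 2] is the exponent that goes with
     [alpha (S k)]. *)
  set (n := fun k => INR (S (S k))).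
  assert (Hn : forall k, 2 <= n k).
  { intros k; unfold n; rewrite !S_INR; assert (P := pos_INR k); lra. }
  assert (Hnv : forall k, n k * Cmod (alpha (S k)) * r ^ S k <= / 2 * v k).
  { intros k; unfold v; fold (n k).
    assert (P : 0 <= n k * Cmod (alpha (S k)) * r ^ S k).
    { apply Rmult_le_pos; [apply Rmult_le_pos | apply pow_le; lra].
      - specialize (Hn k); lra.
      - apply Cmod_ge_0. }
    assert (B := Rmult_le_compat_l _ _ _ P (Hn k)); lra. }
  set (dterm := fun w k => (alpha k * RtoC (INR (S k)) * w ^ k)%C).
  assert (Hdterm : forall w k, Cmod (dterm w (S k)) =
      n k * Cmod (alpha (S k)) * Cmod w ^ S k).
  { intros w k; unfold dterm; rewrite !Cmod_mult, Cmod_pow, Cmod_R, Rabs_pos_eq.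
    - unfold n; ring.
    - apply pos_INR. }
  assert (Hd1 : forall w k, Cmod w <= r -> Cmod (dterm w (S k)) <= / 2 * v k).
  { intros w k Hw; apply Rle_trans with (2 := Hnv k); rewrite Hdterm.
    apply Rmult_le_compat_l.
    - apply Rmult_le_pos; [specialize (Hn k); lra | apply Cmod_ge_0].
    - apply pow_incr; split; [apply Cmod_ge_0 | exact Hw]. }
  (* The sum of the termwise derivatives; that it is the derivative of [f] will follow from the
     quadratic remainder. *)
  set (D := fun w => @iota C_CompleteNormedModule
    (@is_series C_AbsRing C_NormedModule (dterm w))).
  assert (HD : forall w, Cmod w <= r ->
    @is_series C_AbsRing C_NormedModule (dterm w) (D w)).
  { intros w Hw; apply iota_is_series.
    apply (@ex_series_incr_1 C_AbsRing C_NormedModule).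
    apply (@ex_series_le C_AbsRing C_CompleteNormedModule) with (fun k => / 2 * v k).
    - intros k; now apply Hd1.
    - apply (@ex_series_scal_l R_AbsRing); now exists s. }
  assert (HDtail : forall w, Cmod w <= r ->
    @is_series C_AbsRing C_NormedModule (fun k => dterm w (S k)) (D w - 1)%C).
  { intros w Hw.
    replace (D w - 1)%C with (D w - dterm w 0%nat)%C
      by (unfold dterm; rewrite Ha0; simpl; ring).
    now apply is_series_C_tail, HD. }
  assert (HDclose : forall w, Cmod w <= r -> Cmod (D w - 1) <= / 2).
  { intros w Hw; apply Rle_trans with (/ 2 * s); [| lra].
    apply (is_series_Cmod_le _ (fun k => / 2 * v k) _ _ (fun k => Hd1 w k Hw)
      (HDtail w Hw)).
    now apply (@is_series_scal R_AbsRing R_NormedModule). }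
  assert (Hdiff : forall z w, Cmod z <= r -> Cmod w <= r ->
    @is_series C_AbsRing C_NormedModule
      (fun k => alpha (S k) * (z ^ S (S k) - w ^ S (S k)))%C (f z - f w - (z - w))%C).
  { intros z w Hz Hw.
    assert (H := is_series_C_tail _ _
      (@is_series_minus C_AbsRing C_NormedModule _ _ _ _ (Hf z Hz) (Hf w Hw))).
    replace (f z - f w - (z - w))%C
      with (f z - f w - (alpha 0%nat * z ^ 1 - alpha 0%nat * w ^ 1))%C
      by (rewrite Ha0; simpl; ring).
    apply (@is_series_ext C_AbsRing C_NormedModule) with (2 := H).
    intros k; rewrite !Nat.add_1_r.
    change (alpha (S k) * z ^ S (S k) - alpha (S k) * w ^ S (S k) =
      alpha (S k) * (z ^ S (S k) - w ^ S (S k)))%C; ring. }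
  assert (Hrem : forall z w, Cmod z <= r -> Cmod w <= r ->
    @is_series C_AbsRing C_NormedModule
      (fun k => alpha (S k) * (z ^ S (S k) - w ^ S (S k)
        - RtoC (n k) * w ^ S k * (z - w)))%C (f z - f w - D w * (z - w))%C).
  { intros z w Hz Hw.
    assert (H := @is_series_minus C_AbsRing C_NormedModule _ _ _ _ (Hdiff z w Hz Hw)
      (@is_series_scal C_AbsRing C_NormedModule (z - w)%C _ _ (HDtail w Hw))).
    replace (f z - f w - D w * (z - w))%C
      with (f z - f w - (z - w) - (z - w) * (D w - 1))%C by ring.
    apply (@is_series_ext C_AbsRing C_NormedModule) with (2 := H).
    intros k; unfold dterm; fold (n k).
    change (alpha (S k) * (z ^ S (S k) - w ^ S (S k)) -
      (z - w) * (alpha (S k) * RtoC (n k) * w ^ S k) =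
      alpha (S k) * (z ^ S (S k) - w ^ S (S k) - RtoC (n k) * w ^ S k * (z - w)))%C.
    ring. }
  assert (HremB : forall z w rho k, Cmod z <= rho -> Cmod w <= rho ->
    rho * Cmod (alpha (S k) * (z ^ S (S k) - w ^ S (S k)
      - RtoC (n k) * w ^ S k * (z - w))) <=
    (n k ^ 2 - n k) * Cmod (alpha (S k)) * rho ^ S k * (Cmod (z - w) ^ 2 / 2)).
  { intros z w rho k Hz Hw; rewrite Cmod_mult.
    assert (B := Cpow_taylor_bound z w rho (S k) Hz Hw); fold (n k) in B.
    replace (INR (S k)) with (n k - 1) in B by (unfold n; rewrite (S_INR (S k)); ring).
    apply (Rmult_le_compat_l (Cmod (alpha (S k)))) in B; [| apply Cmod_ge_0].
    lra. }
  assert (Hzero : is_series (fun _ : nat => 0) 0).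
  { assert (H : is_series (fun k => 0 * v k) (0 * s))
      by now apply (@is_series_scal R_AbsRing R_NormedModule).
    rewrite Rmult_0_l in H; apply is_series_ext with (2 := H); intros k; apply Rmult_0_l. }
  (* [1 / (2 r)] comes from [HremB] with [rho = r], using [n^2 - n <= n^2] and [s <= 1]. *)
  apply convex_in_disk_of_estimates with D (/ (2 * r)); trivial.
  - assert (H := Hf 0 ltac:(rewrite Cmod_0; lra)).
    apply Cmod_eq_0, Rle_antisym; [| apply Cmod_ge_0].
    apply (is_series_Cmod_le _ (fun _ => 0) _ _) with (2 := H).
    + intros k; rewrite Nat.add_1_r.
      change (Cmod (alpha k * 0 ^ S k) <= 0); simpl Cpow.
      replace (alpha k * (0 * 0 ^ k))%C with (RtoC 0) by ring.
      rewrite Cmod_0; lra.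
    + exact Hzero.
  - assert (H := HDtail 0 ltac:(rewrite Cmod_0; lra)).
    apply (Cmod_eq_0_sub (D 0) 1).
    apply (is_series_Cmod_le _ (fun _ => 0) _ _) with (2 := H).
    + intros k; change (Cmod (dterm 0 (S k)) <= 0); rewrite Hdterm, Cmod_0; simpl; lra.
    + exact Hzero.
  - intros z w Hz Hw.
    apply Rle_trans with (/ 2 * Cmod (z - w) * s).
    2: { assert (P := Cmod_ge_0 (z - w)); nra. }
    apply (is_series_Cmod_le _ (fun k => / 2 * Cmod (z - w) * v k) _ _) with
      (2 := Hdiff z w Hz Hw).
    2: now apply (@is_series_scal R_AbsRing R_NormedModule).
    intros k; change (Cmod (alpha (S k) * (z ^ S (S k) - w ^ S (S k))) <=
      / 2 * Cmod (z - w) * v k).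
    rewrite Cmod_mult.
    assert (B := Cpow_sub_bound z w r (S k) Hz Hw); fold (n k) in B.
    apply (Rmult_le_compat_l (Cmod (alpha (S k)))) in B; [| apply Cmod_ge_0].
    assert (B' := Rmult_le_compat_r _ _ _ (Cmod_ge_0 (z - w)) (Hnv k)).
    lra.
  - intros z w Hz Hw.
    apply Rmult_le_reg_l with r; [exact Hr |].
    apply Rle_trans with (Cmod (z - w) ^ 2 / 2 * s).
    2: { replace (r * (/ (2 * r) * Cmod (z - w) ^ 2)) with (Cmod (z - w) ^ 2 / 2)
           by (field; lra).
         assert (P := pow2_ge_0 (Cmod (z - w))); nra. }
    replace (r * Cmod (f z - f w - D w * (z - w)))
      with (Cmod (RtoC r * (f z - f w - D w * (z - w)))).
    2: rewrite Cmod_mult, Cmod_R, Rabs_pos_eq; lra.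
    apply (is_series_Cmod_le _ (fun k => Cmod (z - w) ^ 2 / 2 * v k) _ _) with
      (2 := @is_series_scal C_AbsRing C_NormedModule (RtoC r) _ _ (Hrem z w Hz Hw)).
    2: now apply (@is_series_scal R_AbsRing R_NormedModule).
    intros k; change (Cmod (RtoC r * (alpha (S k) * (z ^ S (S k) - w ^ S (S k)
      - RtoC (n k) * w ^ S k * (z - w)))) <= Cmod (z - w) ^ 2 / 2 * v k).
    rewrite Cmod_mult, Cmod_R, Rabs_pos_eq by lra.
    apply Rle_trans with (1 := HremB z w r k Hz Hw).
    rewrite (Rmult_comm (Cmod (z - w) ^ 2 / 2)); apply Rmult_le_compat_r.
    + assert (P := pow2_ge_0 (Cmod (z - w))); lra.
    + unfold v; fold (n k).
      apply Rmult_le_compat_r; [apply pow_le; lra |].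
      apply Rmult_le_compat_r; [apply Cmod_ge_0 |].
      specialize (Hn k); lra.
  - intros z w [Hzw Hw]; set (rho := Cmod w) in *.
    assert (Hrho : 0 <= rho) by apply Cmod_ge_0.
    (* Let [P] and [Q] be the sums of [p] and [q], and [T] the remainder. Then
       [rho |T| <= (Q - P) |z - w|^2 / 2] and [|D w| >= 1 - P], so [Q <= 1] yields the supporting
       estimate. *)
    set (p := fun k => n k * Cmod (alpha (S k)) * rho ^ S k).
    set (q := fun k => n k ^ 2 * Cmod (alpha (S k)) * rho ^ S k).
    assert (Hqv : forall k, 0 <= q k <= v k).
    { intros k; unfold q, v; fold (n k).
      assert (P : 0 <= n k ^ 2 * Cmod (alpha (S k)))
        by (apply Rmult_le_pos; [apply pow2_ge_0 | apply Cmod_ge_0]).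
      split; [apply Rmult_le_pos; trivial; now apply pow_le |].
      apply Rmult_le_compat_l; trivial; now apply pow_incr. }
    assert (Hpq : forall k, 0 <= p k <= q k).
    { intros k; unfold p, q.
      assert (P : 0 <= Cmod (alpha (S k)) * rho ^ S k)
        by (apply Rmult_le_pos; [apply Cmod_ge_0 | now apply pow_le]).
      rewrite !Rmult_assoc; specialize (Hn k).
      split; [apply Rmult_le_pos; lra |].
      apply Rmult_le_compat_r; [exact P | nra]. }
    assert (Eq : ex_series q).
    { apply (@ex_series_le R_AbsRing R_CompleteNormedModule) with v; [| now exists s].
      intros k; change (Rabs (q k) <= v k); rewrite Rabs_pos_eq; apply Hqv. }
    assert (Ep : ex_series p).
    { apply (@ex_series_le R_AbsRing R_CompleteNormedModule) with q; [| exact Eq].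
      intros k; change (Rabs (p k) <= q k); rewrite Rabs_pos_eq; apply Hpq. }
    destruct Eq as [Q HQ]; destruct Ep as [P HP].
    assert (HQ1 : Q <= 1).
    { apply Rle_trans with (1 := Rle_abs Q), Rle_trans with (2 := Hs1).
      apply (is_series_norm_le q v) with (2 := HQ) (3 := Hs).
      intros k; change (Rabs (q k) <= v k); rewrite Rabs_pos_eq; apply Hqv. }
    assert (HDP : 1 - P <= Cmod (D w)).
    { assert (B : Cmod (D w - 1) <= P).
      { apply (is_series_Cmod_le _ p) with (2 := HDtail w Hw) (3 := HP).
        intros k; change (Cmod (dterm w (S k)) <= p k); rewrite Hdterm; apply Rle_refl. }
      assert (T := Cmod_triangle (D w) (- (D w - 1))).
      replace (D w + - (D w - 1))%C with (RtoC 1) in T by ring.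
      rewrite Cmod_1, Cmod_opp in T; lra. }
    assert (HT : rho * Cmod (f z - f w - D w * (z - w)) <=
      Cmod (z - w) ^ 2 / 2 * (Q - P)).
    { replace (rho * Cmod (f z - f w - D w * (z - w)))
        with (Cmod (RtoC rho * (f z - f w - D w * (z - w)))).
      2: rewrite Cmod_mult, Cmod_R, Rabs_pos_eq; lra.
      apply (is_series_Cmod_le _ (fun k => Cmod (z - w) ^ 2 / 2 * (q k - p k)) _ _) with
        (2 := @is_series_scal C_AbsRing C_NormedModule (RtoC rho) _ _
          (Hrem z w ltac:(lra) Hw)).
      2: { apply (@is_series_scal R_AbsRing R_NormedModule _ (fun k => q k - p k)).
           now apply (@is_series_minus R_AbsRing R_NormedModule). }
      intros k; change (Cmod (RtoC rho * (alpha (S k) * (z ^ S (S k) - w ^ S (S k)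
        - RtoC (n k) * w ^ S k * (z - w)))) <= Cmod (z - w) ^ 2 / 2 * (q k - p k)).
      rewrite Cmod_mult, Cmod_R, Rabs_pos_eq by lra.
      apply Rle_trans with (1 := HremB z w rho k Hzw (Rle_refl _)).
      apply Req_le; unfold p, q; ring. }
    assert (F := pow2_ge_0 (Cmod (z - w))); nra.
Qed.

(** * Log-concave coefficients: numerical bounds and convexity in the half disk *)

(** The value [8/3] is what makes [3 (e - 1) >= 5]. In [(1 + 1/n)^n <= e], the choice [n = 32]
    suffices, whereas [n = 16] would not. *)
Lemma exp_1_ge : 8 / 3 <= exp 1.
Proof.
  set (x := exp (/ 32)).
  assert (H : 33 / 32 <= x).
  { assert (E := exp_ineq1_le (/ 32)); fold x in E; lra. }
  replace (exp 1) with (x ^ 32).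
  - apply Rle_trans with ((33 / 32) ^ 32); [lra |].
    apply pow_incr; lra.
  - unfold x; simpl pow; rewrite Rmult_1_r, <- !exp_plus; f_equal; field.
Qed.

(* The ratios [c (k+1) / c k] decrease; the condition on [c 1] and [c 2] forces
   them below [3/10] from [k = 1] on, and [(k+4)/(k+3) * 3/10 <= 2/5]. *)
Lemma log_concave_geometric_bound (c : nat -> R) :
  (forall k, 0 < c k) -> c 0%nat = 1 ->
  (forall k, c k * c (S (S k)) <= c (S k) ^ 2) -> 2 * c 1%nat + 5 * c 2%nat < 1 ->
  forall k, INR (k + 3) * c (S (S k)) <= 3 * c 2%nat * (2 / 5) ^ k.
Proof.
  intros Hpos H0 Hlc H12.
  assert (Hr : forall k, c 1%nat * c (S (S k)) <= c 2%nat * c (S k)).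
  { induction k as [| k IH]; [lra |].
    assert (P1 := Hpos (S k)); assert (P2 := Hpos (S (S k))).
    assert (P := Hpos 1%nat); assert (L := Hlc (S k)).
    apply Rmult_le_reg_l with (c (S k)); [exact P1 |].
    apply (Rmult_le_compat_l (c 1%nat)) in L; [| lra].
    apply (Rmult_le_compat_r (c (S (S k)))) in IH; [| lra].
    lra. }
  assert (H21 : c 2%nat <= 3 / 10 * c 1%nat).
  { assert (L := Hlc 0%nat); rewrite H0 in L.
    assert (P1 := Hpos 1%nat); assert (P2 := Hpos 2%nat).
    (* Otherwise [c 2 <= (c 1)^2] forces [c 1 > 3/10], and then
       [2 c 1 + 5 c 2 > (7/2) c 1 > 21/20]. *)
    apply Rnot_lt_le; intros Hlt.
    assert (3 / 10 < c 1%nat) by nra.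
    nra. }
  induction k as [| k IH]; [simpl; lra |].
  assert (P := Hpos (S (S k))); assert (P' := Hpos (S (S (S k)))).
  assert (P1 := Hpos 1%nat).
  assert (R : c (S (S (S k))) <= 3 / 10 * c (S (S k))).
  { apply Rmult_le_reg_l with (c 1%nat); [exact P1 |].
    assert (A := Hr (S k)); nra. }
  replace (INR (S k + 3)) with (INR k + 4) by (rewrite plus_INR, S_INR; simpl; ring).
  replace (INR (k + 3)) with (INR k + 3) in IH by (rewrite plus_INR; simpl; ring).
  assert (Pk := pos_INR k); simpl pow.
  assert ((INR k + 4) * c (S (S (S k))) <= (INR k + 4) * (3 / 10 * c (S (S k))))
    by (apply Rmult_le_compat_l; lra).
  nra.
Qed.

Lemma INR_le_pow2 (n : nat) : INR (S n) <= 2 ^ n.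
Proof.
  induction n as [| n IH]; [simpl; lra |].
  rewrite S_INR; simpl pow.
  assert (P := pow_R1_Rle 2 n ltac:(lra)); lra.
Qed.

Lemma log_concave_convex_in_half_disk (c : nat -> R) (f : C -> C) :
  (forall k, 0 < c k) -> c 0%nat = 1 ->
  (forall k, c k * c (S (S k)) <= c (S k) ^ 2) -> 2 * c 1%nat + 5 * c 2%nat < 1 ->
  (forall z, f z = @iota C_CompleteNormedModule (@is_series C_AbsRing C_NormedModule
    (fun k => (RtoC (c k) * z ^ (k + 1))%C))) ->
  convex_in_disk f (1 / 2).
Proof.
  intros Hpos H0 Hlc H12 Hf.
  assert (Hc : forall k, Cmod (RtoC (c k)) = c k)
    by (intros k; rewrite Cmod_R; apply Rabs_pos_eq, Rlt_le, Hpos).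
  set (v := fun k => INR (S (S k)) ^ 2 * Cmod (RtoC (c (S k))) * (1 / 2) ^ S k).
  assert (Hv : forall k, 0 <= v k <= INR (S (S k)) * c (S k)).
  { intros k; unfold v; rewrite Hc.
    assert (P := Hpos (S k)); assert (Q := pos_INR (S (S k))).
    assert (H2 := INR_le_pow2 (S k)).
    assert (P2 : 0 < 2 ^ S k) by (apply pow_lt; lra).
    unfold Rdiv; rewrite Rmult_1_l, pow_inv.
    assert (B : 0 <= INR (S (S k)) * / 2 ^ S k <= 1).
    { split; [apply Rmult_le_pos; [exact Q | apply Rlt_le, Rinv_0_lt_compat, P2] |].
      rewrite <- (Rinv_r (2 ^ S k)) by lra.
      apply Rmult_le_compat_r; [apply Rlt_le, Rinv_0_lt_compat, P2 | exact H2]. }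
    replace (INR (S (S k)) ^ 2 * c (S k) * / 2 ^ S k)
      with (INR (S (S k)) * c (S k) * (INR (S (S k)) * / 2 ^ S k)) by ring.
    assert (0 <= INR (S (S k)) * c (S k)) by (apply Rmult_le_pos; lra).
    nra. }
  (* The geometric bound starts at [c 2], so the term with [c 1] stands apart;
     [3 c 2 / (1 - 2/5) = 5 c 2] is the source of the 5 in the hypothesis. *)
  set (w := fun k => match k with O => 2 * c 1%nat
                                | S j => 3 * c 2%nat * (2 / 5) ^ j end).
  assert (Hw : is_series w (2 * c 1%nat + 5 * c 2%nat)).
  { apply (@is_series_decr_1 R_AbsRing R_NormedModule).
    change (is_series (fun j => 3 * c 2%nat * (2 / 5) ^ j)
      (2 * c 1%nat + 5 * c 2%nat + - (2 * c 1%nat))).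
    replace (2 * c 1%nat + 5 * c 2%nat + - (2 * c 1%nat))
      with (3 * c 2%nat * / (1 - 2 / 5)) by field.
    apply (@is_series_scal R_AbsRing R_NormedModule), is_series_geom.
    rewrite Rabs_pos_eq; lra. }
  assert (Hvw : forall k, Rabs (v k) <= w k).
  { intros k; rewrite Rabs_pos_eq by apply Hv.
    apply Rle_trans with (1 := proj2 (Hv k)).
    destruct k as [| k]; [simpl; lra |].
    assert (B := log_concave_geometric_bound c Hpos H0 Hlc H12 k).
    rewrite <- (Nat.add_comm 3) in B; exact B. }
  assert (Hex : ex_series v).
  { apply (@ex_series_le R_AbsRing R_CompleteNormedModule) with w; [exact Hvw |].
    eexists; exact Hw. }
  destruct Hex as [s Hs].
  apply convex_in_disk_of_coefficients with (fun k => RtoC (c k)) s; [lra | | | exact Hs |].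
  - now rewrite H0.
  - intros z Hz; rewrite Hf; apply iota_is_series.
    (* [v] starts at the coefficient [c 1], so the first term is dropped; [v] dominates the rest
       because [|z| <= 1/2] and its weights are at least 1. *)
    apply (@ex_series_incr_1 C_AbsRing C_NormedModule).
    apply (@ex_series_le C_AbsRing C_CompleteNormedModule) with v; [| now exists s].
    intros k; change (Cmod (RtoC (c (S k)) * z ^ (S k + 1)) <= v k).
    rewrite Cmod_mult, Cmod_pow; unfold v.
    assert (P1 : 1 <= INR (S (S k)) ^ 2).
    { rewrite !S_INR; assert (P := pos_INR k); nra. }
    assert (P2 : Cmod z ^ (S k + 1) <= (1 / 2) ^ S k).
    { apply Rle_trans with ((1 / 2) ^ (S k + 1)).
      - apply pow_incr; split; [apply Cmod_ge_0 | exact Hz].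
      - assert (P := pow_lt (1 / 2) (S k) ltac:(lra)).
        rewrite pow_add; simpl pow in *; lra. }
    assert (P3 := Cmod_ge_0 (RtoC (c (S k)))).
    apply (Rmult_le_compat_l _ _ _ P3) in P2.
    apply Rle_trans with (1 := P2).
    rewrite Rmult_assoc; rewrite <- (Rmult_1_l (_ * (1 / 2) ^ S k)) at 1.
    apply Rmult_le_compat_r; [| exact P1].
    apply Rmult_le_pos; [exact P3 | apply pow_le; lra].
  - apply Rle_trans with (1 := Rle_abs s).
    apply Rle_trans with (2 := Rlt_le _ _ H12).
    exact (is_series_norm_le v w s _ Hvw Hs Hw).
Qed.

(** * The Wright coefficients and the conclusion *)

Lemma Wright_coef_pos (mu a nu b : R) (k : nat) :
  0 < a -> 0 < b -> 0 < mu -> 0 < nu -> 0 < Wright_coef mu a nu b k.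
Proof.
  intros Ha Hb Hmu Hnu; assert (P := pos_INR k).
  unfold Wright_coef; apply Rdiv_lt_0_compat; apply Rmult_lt_0_compat;
    apply Gamma_pos; nra.
Qed.

(** Log-convexity of [Gamma] along the progressions with steps [mu] and [nu] gives two inequalities;
    they multiply, and taking reciprocals reverses the product. *)
Lemma Wright_coef_log_concave (mu a nu b : R) (k : nat) :
  0 < a -> 0 < b -> 0 < mu -> 0 < nu ->
  Wright_coef mu a nu b k * Wright_coef mu a nu b (S (S k)) <=
    Wright_coef mu a nu b (S k) ^ 2.
Proof.
  intros Ha Hb Hmu Hnu; assert (P := pos_INR k).
  unfold Wright_coef.
  assert (Ga := Gamma_log_convex (a + INR k * mu) mu ltac:(nra) Hmu).
  assert (Gb := Gamma_log_convex (b + INR k * nu) nu ltac:(nra) Hnu).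
  replace (a + INR k * mu + mu) with (a + INR (S k) * mu) in Ga
    by (rewrite S_INR; ring).
  replace (a + INR k * mu + 2 * mu) with (a + INR (S (S k)) * mu) in Ga
    by (rewrite !S_INR; ring).
  replace (b + INR k * nu + nu) with (b + INR (S k) * nu) in Gb
    by (rewrite S_INR; ring).
  replace (b + INR k * nu + 2 * nu) with (b + INR (S (S k)) * nu) in Gb
    by (rewrite !S_INR; ring).
  assert (Pos : forall x m j, 0 < x -> 0 < m -> 0 < Gamma (x + INR j * m)).
  { intros x m j Hx Hm; apply Gamma_pos; assert (Q := pos_INR j); nra. }
  assert (A0 := Pos a mu k Ha Hmu); assert (A1 := Pos a mu (S k) Ha Hmu).
  assert (A2 := Pos a mu (S (S k)) Ha Hmu).
  assert (B0 := Pos b nu k Hb Hnu); assert (B1 := Pos b nu (S k) Hb Hnu).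
  assert (B2 := Pos b nu (S (S k)) Hb Hnu).
  set (M := Gamma a * Gamma b).
  set (a0 := Gamma (a + INR k * mu)) in *.
  set (a1 := Gamma (a + INR (S k) * mu)) in *.
  set (a2 := Gamma (a + INR (S (S k)) * mu)) in *.
  set (b0 := Gamma (b + INR k * nu)) in *.
  set (b1 := Gamma (b + INR (S k) * nu)) in *.
  set (b2 := Gamma (b + INR (S (S k)) * nu)) in *.
  replace (M / (a0 * b0) * (M / (a2 * b2))) with (M ^ 2 * / (a0 * a2 * (b0 * b2)))
    by (field; lra).
  replace ((M / (a1 * b1)) ^ 2) with (M ^ 2 * / (a1 ^ 2 * b1 ^ 2)) by (field; lra).
  apply Rmult_le_compat_l; [apply pow2_ge_0 |].
  apply Rinv_le_contravar.
  - apply Rmult_lt_0_compat; now apply pow_lt.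
  - apply Rmult_le_compat; trivial; apply pow2_ge_0.
Qed.

Theorem theorem3p2 (a b mu nu : R)
  (ha : 0 < a) (hb : 0 < b) (hmu : 0 < mu) (hnu : 0 < nu)
  (h1 : Gamma (a + 2 * mu) / Gamma (a + 3 * mu) <
        (3 * Gamma (b + 3 * nu)) / (8 * Gamma (b + 2 * nu)))
  (h2 : (Gamma (a + mu) * Gamma (a + 3 * mu)) / (Gamma (a + 2 * mu)) ^ 2 <
        (16 * (Gamma (b + 2 * nu)) ^ 2) /
        (9 * Gamma (b + nu) * Gamma (b + 3 * nu)))
  (h3 : (2 * Gamma a * Gamma b) / (Gamma (a + mu) * Gamma (b + nu)) -
        (3 * (1 - exp 1) * Gamma a * Gamma b) /
        (Gamma (a + 2 * mu) * Gamma (b + 2 * nu)) < 1) :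
  convex_in_disk (Wright mu a nu b) (1 / 2).
Proof.
  assert (Hpos : forall k, 0 < Wright_coef mu a nu b k)
    by (intros k; now apply Wright_coef_pos).
  apply log_concave_convex_in_half_disk with (Wright_coef mu a nu b).
  - exact Hpos.
  - assert (A := Gamma_pos a ha); assert (B := Gamma_pos b hb).
    unfold Wright_coef; simpl INR.
    rewrite !Rmult_0_l, !Rplus_0_r; field; lra.
  - intros k; now apply Wright_coef_log_concave.
  - assert (P := Hpos 2%nat); assert (E := exp_1_ge).
    (* This is [h3] with the sign of [1 - e] absorbed; [exp_1_ge] then lowers the factor [3 (e - 1)]
       to 5. *)
    assert (H : 2 * Wright_coef mu a nu b 1 +
      3 * (exp 1 - 1) * Wright_coef mu a nu b 2 < 1).
    { eapply Rle_lt_trans with (2 := h3); apply Req_le.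
      unfold Wright_coef; change (INR 1) with 1; change (INR 2) with 2.
      rewrite !Rmult_1_l; unfold Rdiv; ring. }
    nra.
  - easy.
Qed.
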